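(* Let $X=(X_1,\dots,X_d)$ be a random vector with independent components, let $c(X)=(c_1(X),\dots,c_m(X))^\top$ be a square-integrable random vector which is a measurable function of $X$, and for each $\ell\in\{1,\dots,L\}$ let $v_{\cdot,\ell}=(v_{1,\ell},\dots,v_{m,\ell})^\top\in\mathbb{R}^m$ be a deterministic vector. Set $$y_\ell(X)=\sum_{i=1}^m c_i(X)\,v_{i,\ell}=v_{\cdot,\ell}^\top\, c(X),$$ and assume $\mathrm{Var}(y_\ell(X))\neq 0$. Then, for all $I\subseteq\{1,\dots,d\}$, $$S_I^{\mathrm{c}}(y_\ell(X))=\frac{v_{\cdot,\ell}^\top\, D_I^{\mathrm{c}}(c(X))\, v_{\cdot,\ell}}{v_{\cdot,\ell}^\top\,\mathrm{Cov}(c(X))\, v_{\cdot,\ell}}.$$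
   Context: For $I\subseteq\{1,\dots,d\}$, $X_I=(X_i)_{i\in I}$, and $\mathbb{E}[\,\cdot\mid X_\emptyset]=\mathbb{E}[\,\cdot\,]$. For a square-integrable scalar random variable $Y=f(X)$ with nonzero variance, the (normalized) closed Sobol' index associated with $I$ is $S_I^{\mathrm{c}}(Y)=\mathrm{Var}(\mathbb{E}[Y\mid X_I])/\mathrm{Var}(Y)$. For a square-integrable random vector $Y=f(X)\in\mathbb{R}^m$, the unnormalized closed Sobol' index is the $m\times m$ covariance matrix $D_I^{\mathrm{c}}(Y)=\mathrm{Cov}(\mathbb{E}[Y\mid X_I])$. $\mathrm{Cov}(Y)$ denotes the covariance matrix of the random vector $Y$. *)

(* Defs.v *)
From HB Require Import structures.
From mathcomp Require Import all_boot all_order all_algebra.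
From mathcomp Require Import all_classical all_reals all_analysis.

Set Implicit Arguments.
Unset Strict Implicit.
Unset Printing Implicit Defensive.

Import Order.TTheory GRing.Theory Num.Theory.
Import numFieldNormedType.Exports.

Local Open Scope classical_set_scope.
Local Open Scope ring_scope.

Definition component (T S : Type) (n : nat) (Y : T -> n.-tuple S) (k : 'I_n) :
  T -> S := fun w => tnth (Y w) k.

Definition subvector (T S : Type) (n : nat) (X : T -> n.-tuple S)
    (I : {set 'I_n}) : T -> #|I|.-tuple S :=
  fun w => [tuple component X (enum_val k) w | k < #|I|].

Section probability_space.
Context (disp : measure_display) (T : measurableType disp) (R : realType).
Variable P : probability T R.

Definition mutually_independent (n : nat) (X : 'I_n -> T -> R) : Prop :=
  forall (J : {set 'I_n}) (B : 'I_n -> set R),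
    (forall i, measurable (B i)) ->
    P (\bigcap_(i in [set` J]) (X i @^-1` B i)) =
    (\prod_(i in J) P (X i @^-1` B i))%E.

Definition square_integrable (n : nat) (Y : T -> n.-tuple R) : Prop :=
  forall k, component Y k \in Lfun P 2%:E.

(* [Z] is a version of the conditional expectation E[Y | W]. *)
Definition is_condexp (disp' : measure_display) (S : measurableType disp')
    (W : T -> S) (Y Z : T -> R) : Prop :=
  [/\ measurable_fun setT (Z : g_sigma_algebra_preimageType W -> R),
      P.-integrable setT (EFin \o Z) &
      forall A, g_sigma_algebra_preimage W A ->
        (\int[P]_(w in A) (Z w)%:E = \int[P]_(w in A) (Y w)%:E)%E].

(* A chosen version; versions agree almost surely, so that variances and
   covariances do not depend on the choice. The default value [cst 0] is only
   used when there is no version, which cannot happen for [W] measurable and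
   [Y] integrable. *)
Definition condexp (disp' : measure_display) (S : measurableType disp')
    (W : T -> S) (Y : T -> R) : T -> R :=
  xget (cst 0) [set Z | is_condexp W Y Z].

Definition condexp_vec (disp' : measure_display) (S : measurableType disp')
    (W : T -> S) (n : nat) (Y : T -> n.-tuple R) : T -> n.-tuple R :=
  fun w => [tuple condexp W (component Y k) w | k < n].

(* [fine] (here and below) discards no information on square-integrable
   vectors, whose covariances are finite. *)
Definition cov_matrix (n : nat) (Y : T -> n.-tuple R) : 'M[R]_n :=
  \matrix_(i, j) fine (covariance P (component Y i) (component Y j)).

(* For [I = set0] the vector [subvector X I] is constant, it generates the
   trivial sigma-algebra, and conditioning on it yields the expectation. *)
Definition sobol_closed (n : nat) (X : T -> n.-tuple R) (I : {set 'I_n})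
    (Y : T -> R) : R :=
  fine 'V_P[condexp (subvector X I) Y] / fine 'V_P[Y].

Definition sobol_closed_matrix (n : nat) (X : T -> n.-tuple R)
    (I : {set 'I_n}) (m : nat) (Y : T -> m.-tuple R) : 'M[R]_m :=
  cov_matrix (condexp_vec (subvector X I) Y).

End probability_space.

Definition linear_output (R : realType) (d m L : nat)
    (c : d.-tuple R -> m.-tuple R) (v : 'M[R]_(m, L)) (l : 'I_L) :
    d.-tuple R -> R :=
  fun x => \sum_(i < m) tnth (c x) i * v i l.

Definition quadratic_form (R : realType) (m : nat) (A : 'M[R]_m)
    (u : 'cV[R]_m) : R := (u^T *m A *m u) 0 0.

(* Main.v *)
(* The conditional expectation given X_I is linear up to null sets, so that
   E[y_l | X_I] is almost surely the combination of the E[c_i | X_I] with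
   coefficients v_{i,l}. As these are again square integrable, both variances
   expand into quadratic forms by bilinearity of the covariance. Existence of
   conditional expectations comes from the Radon-Nikodym theorem on sigma(X_I).
   Square integrability of Z = E[Y | W] comes from a discretized Jensen
   inequality: where k <= Z < k + 1 with k an integer,
     Z^2 <= 2 k Z - k^2 + 1  and  2 k Y - k^2 + 1 <= Y^2 + 1. *)
Require Import Defs.
From mathcomp Require Import all_boot all_order all_algebra.
From mathcomp Require Import all_classical all_reals all_analysis.
From mathcomp Require Import measurable_realfun.
From mathcomp Require Import lra ring.

Set Implicit Arguments.
Unset Strict Implicit.
Unset Printing Implicit Defensive.

Import Order.TTheory GRing.Theory Num.Theory.
Import numFieldNormedType.Exports.

Local Open Scope classical_set_scope.
Local Open Scope ring_scope.

(** The L2 norm is a power of the integral of [f ^+ 2], hence finite with it. *)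
Lemma integrable_sqr_Lfun2 d (T : measurableType d) (R : realType)
    (mu : {measure set T -> \bar R}) (f : T -> R) :
  measurable_fun setT f -> mu.-integrable setT (EFin \o (fun x => f x ^+ 2)) ->
  f \in Lfun mu 2%:E.
Proof.
move=> mf /integrableP[_ fley]; rewrite inE; apply/andP; split; rewrite inE//=.
rewrite /finite_norm unlock; apply: poweR_lty.
have E x : (`|(EFin \o f) x| `^ 2)%E = `|(f x ^+ 2)%:E|%E.
  by rewrite abse_EFin poweR_EFin powR_mulrn// -normrX.
by under eq_integral do rewrite E.
Qed.

(** * Versions of the conditional expectation given W *)

Section conditional_expectation.
Context d (T : measurableType d) (R : realType) (P : probability T R).
Context d' (S : measurableType d') (W : T -> S).
Hypothesis mW : measurable_fun setT W.

Lemma g_sigma_algebra_preimage_measurable A :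
  g_sigma_algebra_preimage W A -> measurable A.
Proof. by move=> [B mB <-]; exact: mW. Qed.

Lemma measurable_to_preimageType :
  measurable_fun setT (id : T -> g_sigma_algebra_preimageType W).
Proof.
by move=> _ A mA; rewrite setTI; exact: g_sigma_algebra_preimage_measurable.
Qed.

Definition to_preimageType : {mfun T >-> g_sigma_algebra_preimageType W} :=
  mfun_Sub (mem_set measurable_to_preimageType).

(** The restriction of P to sigma(W), as the law of the identity map into the coarser measurable
    space. *)
Let P' := distribution P to_preimageType.

Lemma measurable_preimageType (Z : T -> R) :
  measurable_fun setT (Z : g_sigma_algebra_preimageType W -> R) ->
  measurable_fun setT Z.
Proof. by move=> mZ; exact: measurableT_comp measurable_to_preimageType. Qed.

(** On sigma(W), the signed measure A -> E[Y 1_A] is absolutely continuous with respect to [P']; its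
    density is a version. *)
Lemma is_condexp_ex (Y : T -> R) : P.-integrable setT (EFin \o Y) ->
  exists Z, is_condexp P W Y Z.
Proof.
move=> iY.
have [nu nuE] :
    exists nu : {charge set (g_sigma_algebra_preimageType W) -> \bar R},
    forall A, nu A = (\int[P]_(w in A) (Y w)%:E)%E.
  unshelve eexists (pushforward (induced_charge iY) to_preimageType
    : {charge set _ -> \bar R}) => //.
have numu : nu `<< P'.
  apply/null_content_dominatesP => A mA PA.
  rewrite nuE; apply: null_set_integral => //.
  - exact: g_sigma_algebra_preimage_measurable.
  - by apply: measurable_funTS; exact: measurable_int iY.
pose f := Radon_Nikodym nu P'.
(* The chosen density is finite everywhere, so [fine \o f] is the same function with real values. *)
have fin_f w : f w \is a fin_num by exact: Radon_Nikodym_fin_num.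
have int_f : P'.-integrable setT f by exact: Radon_Nikodym_integrable.
have mf : measurable_fun setT f by exact: measurable_int int_f.
have iPf : P.-integrable setT (f : T -> \bar R).
  move/integrableP: int_f => [_].
  rewrite ge0_integral_distribution//; last first.
    exact: measurableT_comp.
  by move=> fley; apply/integrableP; split=> //;
    exact: measurableT_comp mf measurable_to_preimageType.
have fE : EFin \o (fine \o f) = f by apply/funext => w /=; rewrite fineK.
exists (fine \o f); split.
- by apply/measurable_EFinP; rewrite fE.
- by rewrite fE.
- move=> A mA; rewrite -nuE (Radon_Nikodym_integral numu)//.
  rewrite integral_pushforward//.
    by apply: eq_integral => w _ /=; rewrite fineK.
  by apply: integrableS iPf => //; exact: g_sigma_algebra_preimage_measurable.
Qed.

(** Both versions are sigma(W)-measurable with equal integrals over every set of sigma(W), so they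
    agree outside a [P']-null set, which is also P-null. *)
Lemma is_condexp_ae_unique (Y Z Z' : T -> R) :
  is_condexp P W Y Z -> is_condexp P W Y Z' -> {ae P, forall w, Z w = Z' w}.
Proof.
move=> [mZ iZ ZE] [mZ' iZ' Z'E].
have iEZ D : measurable D ->
    P'.-integrable D
      (EFin \o (Z : g_sigma_algebra_preimageType W -> R)).
  move=> mD; apply: integrable_pushforward => //.
  - exact/measurable_EFinP.
  - by apply: integrableS iZ => //; exact: g_sigma_algebra_preimage_measurable.
case: (@integral_ae_eq _ _ _ P' setT measurableT (EFin \o Z') (EFin \o Z)
  (iEZ _ measurableT)).
- exact/measurable_EFinP.
- move=> E _ mE.
  rewrite !integral_pushforward//.
  + by rewrite /= ZE ?Z'E.
  + exact/measurable_EFinP.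
  + by apply: integrableS iZ' => //; exact: g_sigma_algebra_preimage_measurable.
  + exact/measurable_EFinP.
  + by apply: integrableS iZ => //; exact: g_sigma_algebra_preimage_measurable.
- move=> N [mN PN0 sub]; exists N; split=> //.
  exact: g_sigma_algebra_preimage_measurable.
  by move=> w /= h; apply: sub => /= h'; apply: h; have [] := h' I.
Qed.

(** Each defining condition of a version is stable under finite linear combinations. Since versions
    are combined, no null set enters here. *)
Lemma is_condexp_sum (I : Type) (s : seq I) (a : I -> R) (Y Z : I -> T -> R) :
  (forall i, P.-integrable setT (EFin \o Y i)) ->
  (forall i, is_condexp P W (Y i) (Z i)) ->
  is_condexp P W (fun w => \sum_(i <- s) Y i w * a i)
                 (fun w => \sum_(i <- s) Z i w * a i).
Proof.
move=> iY YZ.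
have EFin_sum (F : I -> T -> R) :
    EFin \o (fun w => \sum_(i <- s) F i w * a i) =
    fun w => (\sum_(i <- s) (a i)%:E * (F i w)%:E)%E.
  apply/funext => w /=; rewrite -sumEFin.
  by apply: eq_bigr => i _; rewrite mulrC.
have int_sum (F : I -> T -> R) A : measurable A ->
    (forall i, P.-integrable setT (EFin \o F i)) ->
    (\int[P]_(w in A) (\sum_(i <- s) F i w * a i)%:E =
     \sum_(i <- s) (a i)%:E * \int[P]_(w in A) (F i w)%:E)%E.
  move=> mA iF.
  have iFA i : P.-integrable A (EFin \o F i) by exact: integrableS (iF i).
  transitivity (\int[P]_(w in A) (\sum_(i <- s) (a i)%:E * (F i w)%:E))%E.
    by apply: eq_integral => w _; exact: (congr1 (@^~ w) (EFin_sum F)).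
  rewrite integral_sum//; last by move=> i; exact: (integrableZl mA _ (iFA i)).
  by apply: eq_bigr => i _; exact: (integralZl mA (iFA i)).
split.
- apply: measurable_sum => i; apply: measurable_funM => //.
  by have [] := YZ i.
- by rewrite EFin_sum; apply: integrable_sum => // i _;
    have [_ iZ _] := YZ i; exact: (integrableZl measurableT _ iZ).
- move=> A mA.
  rewrite !int_sum//; last 3 first.
  + exact: g_sigma_algebra_preimage_measurable.
  + exact: g_sigma_algebra_preimage_measurable.
  + by move=> i; have [] := YZ i.
  by apply: eq_bigr => i _; have [_ _ ->] := YZ i.
Qed.

(** The pieces where k <= Z < k + 1 lie in sigma(W), so affine functions of Z and of Y have equal
    integrals there. The two bounds then compare Z^2 with Y^2 + 1 on each piece, and summing gives
    E[Z^2] <= E[Y^2] + 1. *)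
Lemma is_condexp_Lfun2 (Y Z : T -> R) :
  Y \in Lfun P 2%:E -> is_condexp P W Y Z -> Z \in Lfun P 2%:E.
Proof.
move=> Y2 [mZ iZ ZE].
have mZT := measurable_preimageType mZ.
apply: integrable_sqr_Lfun2 => //.
have iY : P.-integrable setT (EFin \o Y).
  by apply/Lfun1_integrable; apply: Lfun_subset12 Y2; exact: fin_num_measure.
have iY2 := Lfun2_integrable_sqr Y2.
have iY21 : P.-integrable setT (fun w => (Y w ^+ 2)%:E + 1%:E)%E.
  by apply: integrableD => //; exact: (finite_measure_integrable_cst P).
have mZ2 : measurable_fun setT (fun w => (Z w ^+ 2)%:E).
  by apply/measurable_EFinP; exact: measurable_funX.
have mZ2n : measurable_fun setT (fun w => `|(Z w ^+ 2)%:E|%E).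
  exact: measurableT_comp.
apply/integrableP; split => //.
(* [pickle] turns the partition by integer parts into a sequence. *)
pose F (n : nat) := [set w | pickle (Num.floor (Z w)) = n].
(* A code n may be attained by no value of Z; the interval is therefore read off a point of the
   piece. *)
have FE n w : F n w ->
    F n = Z @^-1` `[(Num.floor (Z w))%:~R, (Num.floor (Z w) + 1)%:~R[%classic.
  move=> <-; apply/seteqP; split => v /=.
    by move=> /(pcan_inj pickleK) <-; rewrite in_itv/= Num.Theory.floor_le floorD1_gt.
  by rewrite in_itv/= => vw; congr pickle; exact: floor_def.
have F0 n : F n = set0 \/ exists w, F n w.
  by have [->|/set0P] := eqVneq (F n) set0; [left|right].
have mF n : g_sigma_algebra_preimage W (F n).
  have [->|[w /FE ->]] := F0 n.
    exact: (@measurable0 _ (g_sigma_algebra_preimageType W)).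
  by rewrite -[X in g_sigma_algebra_preimage W X]setTI; exact: mZ.
have mFT n := g_sigma_algebra_preimage_measurable (mF n).
have tF : trivIset setT F by move=> i j _ _ [w [<- <-]].
have UF : \bigcup_n F n = setT.
  by apply/seteqP; split => // w _; exists (pickle (Num.floor (Z w))).
have Fle n : (\int[P]_(w in F n) (`|(Z w ^+ 2)%:E|) <=
              \int[P]_(w in F n) ((Y w ^+ 2)%:E + 1%:E))%E.
  have [->|[w0 Fw0]] := F0 n; first by rewrite !integral_set0.
  have {w0 Fw0} [k kE] : exists k : R, forall w, F n w -> k <= Z w < k + 1.
    exists (Num.floor (Z w0))%:~R => w; rewrite (FE _ _ Fw0)/= in_itv/=.
    by rewrite intrD.
  (* The integrand is the tangent to x^2 at k, raised by 1. Its integral depends on X only through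
     the integral of X over [F n]. *)
  have tangent (X : T -> R) : P.-integrable setT (EFin \o X) ->
      (\int[P]_(w in F n) ((2 * k)%:E * (X w)%:E + (1 - k ^+ 2)%:E) =
       (2 * k)%:E * \int[P]_(w in F n) (X w)%:E +
       (1 - k ^+ 2)%:E * P (F n))%E /\
       P.-integrable (F n) (fun w => (2 * k)%:E * (X w)%:E + (1 - k ^+ 2)%:E)%E.
    move=> iX.
    have iXF : P.-integrable (F n) (EFin \o X) by exact: integrableS iX.
    have iZX : P.-integrable (F n) (fun w => (2 * k)%:E * (X w)%:E)%E.
      exact: integrableZl.
    have ic : P.-integrable (F n) (cst (1 - k ^+ 2)%:E).
      apply: (integrableS measurableT) => //.
      exact: (finite_measure_integrable_cst P).
    split; last exact: integrableD.
    by rewrite integralD// integralZl// integral_cst.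
  have [ZI iZk] := tangent _ iZ; have [YI iYk] := tangent _ iY.
  apply: (@le_trans _ _ (\int[P]_(w in F n)
      ((2 * k)%:E * (Z w)%:E + (1 - k ^+ 2)%:E))%E).
    apply: ge0_le_integral => //.
    - exact: measurable_funTS.
    - exact: measurable_int iZk.
    - move=> w /kE /andP[kZ Zk]; rewrite -EFinM -EFinD lee_fin.
      rewrite ger0_norm ?sqr_ge0//.
      (* The unit length of the interval gives this bound, which rearranges to Z^2 <= 2 k Z - k^2 +
         1. *)
      have : (Z w - k) ^+ 2 <= 1 by rewrite expr_le1//; lra.
      nra.
  (* Z is exchanged for Y by the defining property of E[Y | W] on [F n]. *)
  rewrite ZI ZE// -YI.
  apply: le_integral => //.
  - exact: integrableS iY21.
  - move=> w _; rewrite -EFinM -!EFinD lee_fin.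
    have : 0 <= (Y w - k) ^+ 2 by exact: sqr_ge0.
    nra.
rewrite -UF ge0_integral_bigcup//; last by rewrite UF.
apply: (@le_lt_trans _ _
    (\sum_(n <oo) \int[P]_(w in F n) ((Y w ^+ 2)%:E + 1%:E))%E).
  by apply: lee_nneseries => [n _ _|n _]; [exact: integral_ge0|exact: Fle].
rewrite -ge0_integral_bigcup//.
- by rewrite UF; exact: integrable_lty.
- rewrite UF; exact: measurable_int iY21.
- by move=> w _; rewrite -EFinD lee_fin addr_ge0// sqr_ge0.
Qed.

(** Existence ensures that [xget] selects a genuine version and not its default value. *)
Lemma condexpP (Y : T -> R) : P.-integrable setT (EFin \o Y) ->
  is_condexp P W Y (condexp P W Y).
Proof.
move=> iY; have [Z YZ] := is_condexp_ex iY.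
exact: (xgetPex _ (ex_intro _ Z YZ)).
Qed.

End conditional_expectation.

(** * Variances of linear combinations and of almost surely equal variables *)

Lemma Lfun2_linear_combination d (T : measurableType d) (R : realType)
    (mu : {measure set T -> \bar R}) (I : Type) (s : seq I) (a : I -> R)
    (F : I -> T -> R) :
  (forall i, F i \in Lfun mu 2%:E) ->
  (fun w => \sum_(i <- s) F i w * a i) \in Lfun mu 2%:E.
Proof.
move=> F2; rewrite [X in X \in _](_ : _ = \sum_(i <- s) (a i \o* F i)).
  apply: rpred_sum => [|? i _]; first exact: lee1n.
  by apply: Lfun_scale => //; rewrite ler1n.
by apply/funext => w; rewrite fct_sumE.
Qed.

Lemma covariance_sum_l d (T : measurableType d) (R : realType)
    (P : probability T R) (I : Type) (s : seq I) (a : I -> R)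
    (F : I -> T -> R) (G : T -> R) :
  (forall i, F i \in Lfun P 2%:E) -> G \in Lfun P 2%:E ->
  (covariance P (fun w => \sum_(i <- s) F i w * a i)%R G =
   \sum_(i <- s) (a i)%:E * covariance P (F i) G)%E.
Proof.
move=> F2 G2.
have L12 (f : T -> R) : f \in Lfun P 2%:E -> f \in Lfun P 1%E.
  by move=> f2; apply: Lfun_subset12 f2; exact: fin_num_measure.
elim: s => [|i s IHs].
  rewrite big_nil -[RHS](covariance_cst_l P 0 G); congr covariance.
  by apply/funext => w; rewrite big_nil.
have -> : (fun w => \sum_(j <- i :: s) F j w * a j) =
          ((a i \o* F i) \+ (fun w => \sum_(j <- s) F j w * a j))%R.
  by apply/funext => w; rewrite big_cons.
have aF2 j : (a j \o* F j) \in Lfun P 2%:E.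
  by apply: Lfun_scale => //; rewrite ler1n.
rewrite covarianceDl//; last exact: Lfun2_linear_combination.
rewrite big_cons IHs covarianceZl//; try exact: L12.
exact: Lfun2_mul_Lfun1.
Qed.

(** Bilinearity of the covariance. It serves both for c(X), in the denominator, and for the vector
    of conditional expectations, in the numerator. *)
Lemma variance_linear_combination d (T : measurableType d) (R : realType)
    (P : probability T R) (m : nat) (Y : T -> m.-tuple R) (u : 'cV[R]_m) :
  square_integrable P Y ->
  fine 'V_P[(fun w => \sum_(i < m) component Y i w * u i 0)%R] =
  quadratic_form (cov_matrix P Y) u.
Proof.
move=> Y2.
have L12 (f : T -> R) : f \in Lfun P 2%:E -> f \in Lfun P 1%E.
  by move=> f2; apply: Lfun_subset12 f2; exact: fin_num_measure.
have cfin i j : covariance P (component Y i) (component Y j) \is a fin_num.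
  by apply: covariance_fin_num; [exact: L12|exact: L12|exact: Lfun2_mul_Lfun1].
have y2 : (fun w => \sum_(i < m) component Y i w * u i 0) \in Lfun P 2%:E.
  exact: Lfun2_linear_combination.
rewrite /variance covariance_sum_l//.
transitivity (fine (\sum_(i < m) \sum_(j < m) (u i 0 * (u j 0 *
    fine (covariance P (component Y i) (component Y j))))%:E)%E).
  congr fine; apply: eq_bigr => i _.
  rewrite covarianceC covariance_sum_l// sumEFin -mulr_sumr EFinM -sumEFin.
  congr *%E; apply: eq_bigr => j _.
  by rewrite EFinM fineK// covarianceC.
under eq_bigr do rewrite sumEFin.
(* The product (u^T A) u sums over the column index of A on the outside, hence the exchange. *)
rewrite sumEFin/= /quadratic_form mxE exchange_big/=; apply: eq_bigr => j _.
rewrite mxE mulr_suml; apply: eq_bigr => i _.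
by rewrite !mxE; ring.
Qed.

Lemma ae_eq_variance d (T : measurableType d) (R : realType)
    (P : probability T R) (X Y : T -> R) :
  measurable_fun setT X -> measurable_fun setT Y ->
  {ae P, forall w, X w = Y w} -> 'V_P[X]%E = 'V_P[Y]%E.
Proof.
move=> mX mY [N [mN PN XYN]].
have eE (f g : T -> R) : measurable_fun setT f -> measurable_fun setT g ->
    (forall w, X w = Y w -> f w = g w) -> 'E_P[f]%E = 'E_P[g]%E.
  move=> mf mg fg; rewrite unlock; apply: ae_eq_integral => //.
  - exact/measurable_EFinP.
  - exact/measurable_EFinP.
  - exists N; split=> // w /= h; apply: XYN => /= XYw; apply: h => _.
    by rewrite /= (fg _ XYw).
(* First the means are identified; the squared deviations from this common mean then agree wherever
   X and Y do. *)
rewrite /variance unlock (eE X Y)//; apply: eE.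
- by apply: measurable_funM; apply: measurable_funB.
- by apply: measurable_funM; apply: measurable_funB.
- by move=> w XYw; rewrite !fctE /= XYw.
Qed.

(** * The closed index of a linear output *)

Lemma measurable_subvector d (T : measurableType d) (R : realType) (n : nat)
    (X : T -> n.-tuple R) (I : {set 'I_n}) :
  measurable_fun setT X -> measurable_fun setT (subvector X I).
Proof.
move=> mX; apply/measurable_fun_tnthP => k.
rewrite (_ : _ \o _ = (@tnth _ R ^~ (enum_val k)) \o X).
  exact: measurableT_comp (measurable_tnth _) mX.
by apply/funext => w; rewrite /= tnth_mktuple.
Qed.

Theorem proposition1 (disp : measure_display) (T : measurableType disp)
    (R : realType) (P : probability T R) (d m L : nat)
    (X : {RV P >-> d.-tuple R}) (c : d.-tuple R -> m.-tuple R)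
    (v : 'M[R]_(m, L)) (l : 'I_L)
    (X_indep : mutually_independent P (component X))
    (c_meas : measurable_fun setT c)
    (cX_L2 : square_integrable P (c \o X))
    (var_y : ('V_P[linear_output c v l \o X] <> 0)%E)
    (I : {set 'I_d}) :
  sobol_closed P X I (linear_output c v l \o X) =
    quadratic_form (sobol_closed_matrix P X I (c \o X)) (col l v) /
    quadratic_form (cov_matrix P (c \o X)) (col l v).
Proof.
set W := subvector X I; set Y := c \o X; set u := col l v.
have mW : measurable_fun setT W by exact: measurable_subvector.
have yE : linear_output c v l \o X =
          fun w => \sum_(i < m) component Y i w * u i 0.
  by apply/funext => w; apply: eq_bigr => i _; rewrite mxE.
have L12 (f : T -> R) : f \in Lfun P 2%:E -> P.-integrable setT (EFin \o f).
  move=> f2; apply/Lfun1_integrable.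
  by apply: Lfun_subset12 f2; exact: fin_num_measure.
pose Z := condexp_vec P W Y.
have YZ i : is_condexp P W (component Y i) (component Z i).
  rewrite (_ : component Z i = condexp P W (component Y i)).
    by apply: condexpP => //; exact: L12.
  by apply/funext => w; rewrite /component tnth_mktuple.
have Z2 : square_integrable P Z.
  by move=> i; exact: (is_condexp_Lfun2 mW (cX_L2 i) (YZ i)).
(* The combination of the E[c_i | X_I] is one version of E[y_l | X_I]; [yC] below provides the
   chosen version, which defines the index. *)
have yZ := is_condexp_sum mW (index_enum _) (fun i => u i 0)
  (fun i => L12 _ (cX_L2 i)) YZ.
have y2 : (fun w => \sum_(i < m) component Y i w * u i 0) \in Lfun P 2%:E.
  exact: Lfun2_linear_combination.
have yC := condexpP mW (L12 _ y2).
(* Both quadratic forms become variances again. The denominators then coincide, and the numerators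
   are variances of two versions of E[y_l | X_I]. *)
rewrite /sobol_closed /sobol_closed_matrix -!variance_linear_combination//.
rewrite yE; congr (fine _ / _).
apply: ae_eq_variance.
- by case: yC => + _ _; exact: measurable_preimageType.
- by case: yZ => + _ _; exact: measurable_preimageType.
- exact: is_condexp_ae_unique yC yZ.
Qed.
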